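(* Let $d\ge2$, let $G=(V,E)$ be a network graph, let $\rho$ be a state on the network Hilbert space, and let $$\tilde W_E=-\frac{2d}{d-1}\bigotimes_{e\in E}\Phi_e+\frac{d+1}{d-1}\bigotimes_{e\in E}\frac{\mathbb{I}_e+d\,\Phi_e}{d+1}.$$ Perform the local measurement protocol described in the context on $m$ independent copies of $\rho$, and let $\bar W_E$ be the average of the $m$ single-copy outcomes. Then for every $\epsilon>0$ $$\Pr\big(\bar W_E-\mathrm{Tr}(\tilde W_E\rho)\le-\epsilon\big)\ \le\ \exp\!\Big(-\frac{m\epsilon^2}{8(1+\frac1d)^2}\Big),$$ a bound that does not depend on the size of the network.
   Context: Network: $G=(V,E)$ is a finite connected simple undirected graph with $|V|\ge2$. To each edge $e=\{u,v\}$ is attached $\mathcal{H}_e=\mathbb{C}^d\otimes\mathbb{C}^d$, one tensor factor held by each endpoint; the network Hilbert space is $\bigotimes_{e\in E}\mathcal{H}_e$. $\mathbb{I}_e$ is the identity on $\mathcal{H}_e$ and $\Phi_e=|\phi^+\rangle\langle\phi^+|$ with $|\phi^+\rangle=\frac1{\sqrt d}\sum_{i=0}^{d-1}|ii\rangle$. Let $X|j\rangle=|j+1 \bmod d\rangle$, $Z|j\rangle=e^{2\pi \mathrm{i} j/d}|j\rangle$, and $M_{a,b}=X^aZ^b\otimes X^a(Z^\dagger)^b$ for $a,b\in\mathbb{Z}_d$ (indices modulo $d$). Single-copy protocol: independently for each edge $e\in E$, choose $(a,b)\in\mathbb{Z}_d^2\setminus\{(0,0)\}$ uniformly at random (probability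 $\frac1{d^2-1}$ each) and measure on $\mathcal{H}_e$ the Hermitian observable $\frac{\mathbb{I}}{d^2}+\frac{d^2-1}{2d^2}\big(M_{a,b}+M_{d-a,d-b}\big)$ by measuring each of the two tensor factors locally, in an orthonormal eigenbasis $\{|\psi_k\rangle\}$ of $X^aZ^b$ (eigenvalues $e^{\mathrm{i}\varphi_k}$) and $\{|\psi'_l\rangle\}$ of $X^a(Z^\dagger)^b$ (eigenvalues $e^{\mathrm{i}\varphi'_l}$) respectively; on obtaining $(k,l)$ the recorded result is $m_e=\frac1{d^2}+\frac{d^2-1}{d^2}\cos(\varphi_k+\varphi'_l)$. The single-copy outcome is $$-\frac{2d}{d-1}\prod_{e\in E}m_e+\frac{d+1}{d-1}\prod_{e\in E}\frac{1+d\,m_e}{d+1}.$$ *)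

(* Defs.v *)
From mathcomp Require Import all_boot all_order all_algebra.
From mathcomp Require Import complex mxtens.
From mathcomp Require Import reals sequences exp trigo.
From mathcomp Require Import ring.

Set Implicit Arguments.
Unset Strict Implicit.
Unset Printing Implicit Defensive.

Import Order.TTheory GRing.Theory Num.Theory.
Local Open Scope ring_scope.
Local Open Scope complex_scope.
Local Open Scope sesquilinear_scope.

Definition edge (V : finType) (adj : rel V) : finType :=
  {e : {set V} | [exists u, exists v, adj u v && (e == [set u; v])]}.

(* Each edge carries C^d (x) C^d, with coordinates ordered as in [tensmx]; the
   first factor belongs to one endpoint of the edge and the second factor to
   the other.  The tensor product over all the edges has as its standard basis
   the families of basis indices, one per edge. *)
Definition netdim (E : finType) (d : nat) : nat :=
  #|{ffun E -> 'I_(d * d)}|.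

Definition basis_index (E : finType) (d : nat) (x : 'I_(netdim E d)) :
    {ffun E -> 'I_(d * d)} := enum_val x.

Definition bigtens (R : realType) (E : finType) (d : nat)
    (A : E -> 'M[R[i]]_(d * d)) : 'M[R[i]]_(netdim E d) :=
  \matrix_(x, y) \prod_(e : E) A e (basis_index x e) (basis_index y e).

Definition state (R : realType) (n : nat) (rho : 'M[R[i]]_n) : Prop :=
  [/\ rho \is hermsymmx,
      forall v : 'cV[R[i]]_n, 0 <= (v ^t* *m rho *m v) 0 0
    & \tr rho = 1].

Definition phi_plus (R : realType) (d : nat) : 'cV[R[i]]_(d * d) :=
  (Num.sqrt d%:R)^-1%:C *:
    \sum_(i < d) ((delta_mx i 0 : 'cV_d) *t (delta_mx i 0 : 'cV_d)).

Definition Phi (R : realType) (d : nat) : 'M[R[i]]_(d * d) :=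
  phi_plus R d *m (phi_plus R d) ^t*.

Definition witness (R : realType) (E : finType) (d : nat) :
    'M[R[i]]_(netdim E d) :=
  - (2 * d%:R / (d%:R - 1)) *: bigtens (fun _ : E => Phi R d)
  + ((d%:R + 1) / (d%:R - 1)) *:
      bigtens (fun _ : E => (d%:R + 1)^-1 *: (1%:M + d%:R *: Phi R d)).

Definition expi (R : realType) (x : R) : R[i] := cos x +i* sin x.

Definition shift (R : realType) (d : nat) : 'M[R[i]]_d :=
  \matrix_(i, j) ((i : nat) == (j + 1) %% d)%N%:R.

Definition clock (R : realType) (d : nat) : 'M[R[i]]_d :=
  diag_mx (\row_j expi (2 * pi * j%:R / d%:R)).

Definition weyl1 (R : realType) (d a b : nat) : 'M[R[i]]_d :=
  shift R d ^+ a *m clock R d ^+ b.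

Definition weyl2 (R : realType) (d a b : nat) : 'M[R[i]]_d :=
  shift R d ^+ a *m (clock R d) ^t* ^+ b.

Definition weyl_pair (R : realType) (d a b : nat) : 'M[R[i]]_(d * d) :=
  weyl1 R d a b *t weyl2 R d a b.

Definition setting (d : nat) : finType :=
  {ab : 'I_d * 'I_d | ~~ ((ab.1 == 0%N :> nat) && (ab.2 == 0%N :> nat))}.

Definition observable (R : realType) (d : nat) (s : setting d) :
    'M[R[i]]_(d * d) :=
  let a := (val s).1 in
  let b := (val s).2 in
  (d%:R ^+ 2)^-1 *: 1%:M
  + ((d%:R ^+ 2 - 1) / (2 * d%:R ^+ 2)) *:
      (weyl_pair R d a b + weyl_pair R d (d - a) (d - b)).

(* An orthonormal eigenbasis of [A], with eigenvalues of modulus one given by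
   their arguments.  When [A] has repeated eigenvalues it is not unique. *)
Record eigenbasis (R : realType) (d : nat) (A : 'M[R[i]]_d) := Eigenbasis {
  evec : 'I_d -> 'cV[R[i]]_d;
  phase : 'I_d -> R;
  evec_orthonormal :
    forall k l, ((evec k) ^t* *m evec l) 0 0 = (k == l)%:R;
  evec_eigen : forall k, A *m evec k = expi (phase k) *: evec k }.

(* One run of the protocol: the setting chosen at every edge, and the pair of
   results obtained there. *)
Definition run (E : finType) (d : nat) : finType :=
  ({ffun E -> setting d} * {ffun E -> 'I_d * 'I_d})%type.

Section Protocol.

Context (R : realType) (E : finType) (d : nat).
Context (B1 : forall (e : E) (s : setting d), eigenbasis (weyl1 R d (val s).1 (val s).2)).
Context (B2 : forall (e : E) (s : setting d), eigenbasis (weyl2 R d (val s).1 (val s).2)).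

Definition effect (e : E) (s : setting d) (kl : 'I_d * 'I_d) :
    'M[R[i]]_(d * d) :=
  let u := evec (B1 e s) kl.1 in
  let v := evec (B2 e s) kl.2 in
  (u *m u ^t*) *t (v *m v ^t*).

(* The Born trace is a real number when [rho] is a state; [Re] only moves it
   from [R[i]] to [R]. *)
Definition run_prob (rho : 'M[R[i]]_(netdim E d)) (r : run E d) : R :=
  (\prod_(e : E) (d%:R ^+ 2 - 1)^-1)
  * complex.Re (\tr (rho *m bigtens (fun e => effect e (r.1 e) (r.2 e)))).

Definition edge_result (e : E) (s : setting d) (kl : 'I_d * 'I_d) : R :=
  1 / d%:R ^+ 2
  + (d%:R ^+ 2 - 1) / d%:R ^+ 2
    * cos (phase (B1 e s) kl.1 + phase (B2 e s) kl.2).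

Definition run_outcome (r : run E d) : R :=
  let m e := edge_result e (r.1 e) (r.2 e) in
  - (2 * d%:R / (d%:R - 1)) * (\prod_(e : E) m e)
  + (d%:R + 1) / (d%:R - 1) * (\prod_(e : E) ((1 + d%:R * m e) / (d%:R + 1))).

Definition average_outcome (m : nat) (w : {ffun 'I_m -> run E d}) : R :=
  (\sum_(i < m) run_outcome (w i)) / m%:R.

(* Probability of an event about [m] independent runs, on [m] copies of
   [rho]. *)
Definition Pr (rho : 'M[R[i]]_(netdim E d)) (m : nat)
    (A : pred {ffun 'I_m -> run E d}) : R :=
  \sum_(w : {ffun 'I_m -> run E d} | A w) \prod_(i < m) run_prob rho (w i).

End Protocol.

Lemma expiD (R : realType) (x y : R) : expi (x + y) = expi x * expi y.
Proof.
rewrite /expi cosD sinD; apply/eqP; rewrite eq_complex /=.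
by apply/andP; split; apply/eqP; ring.
Qed.

Lemma expi0 (R : realType) : expi (0 : R) = 1.
Proof. by rewrite /expi cos0 sin0. Qed.

Lemma expiMn (R : realType) (x : R) n : expi (x *+ n) = expi x ^+ n.
Proof.
by elim: n => [|n IH]; rewrite ?mulr0n ?expi0 // mulrS expiD IH exprS.
Qed.

Lemma conj_expi (R : realType) (x : R) : conjc (expi x) = expi (- x).
Proof. by rewrite /expi cosN sinN. Qed.

Lemma shiftX (R : realType) d a (i j : 'I_d) :
  (shift R d ^+ a) i j = ((i : nat) == (j + a) %% d)%N%:R.
Proof.
elim: a i j => [|a IH] i j.
  by rewrite expr0 mxE addn0 modn_small.
rewrite exprSr mxE.
have hd : (0 < d)%N by apply: leq_ltn_trans (ltn_ord i).
pose k := Ordinal (ltn_pmod (j + 1) hd).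
rewrite (bigD1 k) //= big1 ?addr0; last first.
  move=> l lk; rewrite [shift _ _ _ _]mxE (_ : (l : nat) == _ = false) ?mulr0 //.
  by apply/negbTE; apply: contra lk => /eqP h; apply/eqP/val_inj.
by rewrite IH [shift _ _ _ _]mxE eqxx mulr1 /= modnDml addn1 addSnnS.
Qed.

Lemma diagX (C : pzSemiRingType) d (v : 'rV[C]_d) b :
  diag_mx v ^+ b = diag_mx (\row_j (v 0 j ^+ b)).
Proof.
elim: b => [|b IH].
  apply/matrixP => i j. rewrite expr0 !mxE; case: eqP => // ->.
rewrite exprS IH; rewrite [LHS]mulmx_diag; congr diag_mx.
by apply/rowP => j; rewrite !mxE exprS.
Qed.

Lemma adj_tens (R : realType) d (A B : 'M[R[i]]_d) : (A *t B) ^t* = A ^t* *t B ^t*.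
Proof. by rewrite trmx_tens map_mxT. Qed.

Lemma eq_tens (C : pzRingType) d (A B A' B' : 'M[C]_d) :
  (forall i i' j j', A i j * B i' j' = A' i j * B' i' j') -> A *t B = A' *t B'.
Proof.
move=> h; apply/matrixP => x y.
case: (mxtens_indexP x) => i i'; case: (mxtens_indexP y) => j j'.
by rewrite !tensmxE h.
Qed.

Lemma adjE (R : realType) n (M : 'M[R[i]]_n) i j : (M ^t*) i j = conjc (M j i).
Proof. by rewrite !mxE. Qed.

Section Weyl.
Context (R : realType) (d : nat).
Let w : R[i] := expi (2 * pi / d%:R).

Lemma clockE : clock R d = diag_mx (\row_j w ^+ j).
Proof.
congr diag_mx; apply/rowP => j; rewrite !mxE -expiMn; congr expi.
by rewrite -mulr_natr; ring.
Qed.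

Lemma clockCE : (clock R d) ^t* = diag_mx (\row_j (conjc w) ^+ j).
Proof.
rewrite clockE; apply/matrixP => i j; rewrite !mxE rmorphMn rmorphXn eq_sym.
by case: eqP => // ->.
Qed.

Lemma weyl1E a b i j :
  weyl1 R d a b i j = ((i : nat) == (j + a) %% d)%N%:R * w ^+ (j * b).
Proof. by rewrite /weyl1 clockE diagX mul_mx_diag !mxE shiftX exprM. Qed.

Lemma weyl2E a b i j :
  weyl2 R d a b i j = ((i : nat) == (j + a) %% d)%N%:R * (conjc w) ^+ (j * b).
Proof. by rewrite /weyl2 clockCE diagX mul_mx_diag !mxE shiftX exprM. Qed.

Context (hd : (0 < d)%N).

Lemma wd : w ^+ d = 1.
Proof.
rewrite -expiMn -[_ *+ d]mulr_natr divfK ?pnatr_eq0 -?lt0n //.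
rewrite /expi mulr_natl cos2pi mulr2n sinD sinpi mul0r mulr0 addr0.
by [].
Qed.

Lemma wcw : w * conjc w = 1.
Proof. by rewrite /w conj_expi -expiD subrr expi0. Qed.

Lemma cwd : (conjc w) ^+ d = 1.
Proof. by have := congr1 (@conjc R) wd; rewrite rmorphXn rmorph1. Qed.

Lemma wXmod n : w ^+ (n %% d) = w ^+ n.
Proof. by rewrite [in RHS](divn_eq n d) exprD mulnC exprM wd expr1n mul1r. Qed.
Lemma cwXmod n : (conjc w) ^+ (n %% d) = (conjc w) ^+ n.
Proof. by rewrite [in RHS](divn_eq n d) exprD mulnC exprM cwd expr1n mul1r. Qed.

Lemma wcwX n : w ^+ n * (conjc w) ^+ n = 1.
Proof. by rewrite -exprMn wcw expr1n. Qed.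

Lemma wsub j b : (b <= d)%N -> w ^+ (j * (d - b)) = (conjc w) ^+ (j * b).
Proof.
move=> hb; rewrite -[LHS]mulr1 -(wcwX (j * b)) mulrA -exprD -mulnDr subnK //.
by rewrite mulnC exprM wd expr1n mul1r.
Qed.

Lemma cwsub j b : (b <= d)%N -> (conjc w) ^+ (j * (d - b)) = w ^+ (j * b).
Proof. 
move=> hb; rewrite -[LHS]mulr1 -(wcwX (j * b)) [w ^+ _ * _]mulrC mulrA -exprD -mulnDr subnK //.
by rewrite mulnC exprM cwd expr1n mul1r.
Qed.

Lemma adj1E a b i j : ((weyl1 R d a b) ^t*) i j =
  ((j : nat) == (i + a) %% d)%N%:R * (conjc w) ^+ (i * b).
Proof. by rewrite adjE weyl1E rmorphM rmorphXn rmorph_nat. Qed.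

Lemma adj2E a b i j : ((weyl2 R d a b) ^t*) i j =
  ((j : nat) == (i + a) %% d)%N%:R * w ^+ (i * b).
Proof.
rewrite adjE weyl2E rmorphM rmorphXn rmorph_nat; congr (_ * _ ^+ _).
exact: conjcK.
Qed.

Lemma weyl_pair_adj a b : (a <= d)%N -> (b <= d)%N ->
  weyl_pair R d (d - a) (d - b) = (weyl_pair R d a b) ^t*.
Proof.
move=> ha hb; rewrite /weyl_pair adj_tens; apply: eq_tens => i i' j j'.
apply: (etrans (congr2 *%R (weyl1E _ _ _ _) (weyl2E _ _ _ _))).
apply: (etrans _ (esym (congr2 *%R (adj1E _ _ _ _) (adj2E _ _ _ _)))).
rewrite wsub // cwsub //.
have E (k l : 'I_d) : ((k : nat) == (l + (d - a)) %% d)%N = ((l : nat) == (k + a) %% d)%N.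
  apply/eqP/eqP => ->; rewrite modnDml -addnA.
    by rewrite subnK // modnDr modn_small.
  by rewrite subnKC // modnDr modn_small.
rewrite !E.
case: eqP => [jE|_]; last by rewrite !mul0r.
case: eqP => [jE'|_]; last by rewrite !mul0r !mulr0.
rewrite !mul1r !exprM jE jE' wXmod cwXmod -!exprM !mulnDl !exprD.
have := wcwX (a * b).
move: (conjc w ^+ _) (w ^+ (a * b)) => p q pq.
rewrite mulrACA [p * q]mulrC pq mulr1.
by [].
Qed.
End Weyl.


Section Eigenbasis.
Context (R : realType) (d : nat) (A : 'M[R[i]]_d) (B : eigenbasis A).
Let P k := evec B k *m (evec B k) ^t*.

Lemma eb_complete : \sum_k P k = 1%:M.
Proof.
pose U := \matrix_(i, k) evec B k i 0.
have UU : U ^t* *m U = 1%:M.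
  apply/matrixP => k l; have := evec_orthonormal B k l.
  by rewrite !mxE => <-; apply: eq_bigr => i _; rewrite !mxE.
rewrite -(mulmx1C UU); apply/matrixP => i j; rewrite summxE !mxE.
by apply: eq_bigr => k _; rewrite !mxE big_ord1 !mxE.
Qed.

Lemma eb_spectral : A = \sum_k expi (phase B k) *: P k.
Proof.
rewrite -[LHS]mulmx1 -eb_complete mulmx_sumr; apply: eq_bigr => k _.
by rewrite mulmxA evec_eigen scalemxAl.
Qed.
End Eigenbasis.

Lemma tens_sum (R : realType) d (f g : 'I_d -> 'M[R[i]]_d) :
  (\sum_k f k) *t (\sum_l g l) = \sum_kl f kl.1 *t g kl.2.
Proof.
apply/matrixP => x y.
case: (mxtens_indexP x) => i i'; case: (mxtens_indexP y) => j j'.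
rewrite tensmxE !summxE big_distrlr pair_big /=.
by apply: eq_bigr => kl _; rewrite tensmxE.
Qed.

Lemma tens11 (C : comNzRingType) d : (1%:M : 'M[C]_d) *t (1%:M : 'M[C]_d) = 1%:M.
Proof.
apply/matrixP => x y.
case: (mxtens_indexP x) => i i'; case: (mxtens_indexP y) => j j'.
rewrite tensmxE !mxE (can_eq (@mxtens_indexK _ _)) xpair_eqE.
by case: (i == j); case: (i' == j'); rewrite ?mulr1 ?mul0r ?mulr0.
Qed.

Lemma tensZ (C : comNzRingType) d (a b : C) (A B : 'M[C]_d) :
  (a *: A) *t (b *: B) = (a * b) *: (A *t B).
Proof.
apply/matrixP => x y; rewrite [RHS]mxE.
case: (mxtens_indexP x) => i i'; case: (mxtens_indexP y) => j j'.
by rewrite !tensmxE !mxE mulrACA.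
Qed.

Lemma adj_sum (R : realType) n (I : finType) (c : I -> R[i]) (F : I -> 'M[R[i]]_n) :
  (forall k, (F k) ^t* = F k) ->
  (\sum_k c k *: F k) ^t* = \sum_k conjc (c k) *: F k.
Proof.
move=> h; apply/matrixP => i j; rewrite adjE !summxE rmorph_sum.
by apply: eq_bigr => k _; rewrite !mxE -{2}h adjE rmorphM.
Qed.

Lemma adjPP (R : realType) d (u : 'cV[R[i]]_d) : (u *m u ^t*) ^t* = u *m u ^t*.
Proof.
rewrite trmx_mul map_mxM; congr (_ *m _); apply/matrixP => i j; rewrite !mxE.
exact: conjcK.
Qed.

Lemma coefE (R : realType) d (t : R) : (0 < d)%N ->
  (d%:R ^+ 2)^-1 + (d%:R ^+ 2 - 1) / (2 * d%:R ^+ 2) * (expi t + conjc (expi t)) =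
  (1 / d%:R ^+ 2 + (d%:R ^+ 2 - 1) / d%:R ^+ 2 * cos t)%:C :> R[i].
Proof.
move=> hd; have hd0 : (d%:R : R) != 0 by rewrite pnatr_eq0 -lt0n.
have hd1 : (d%:R : R[i]) != 0 by rewrite pnatr_eq0 -lt0n.
have -> : expi t + conjc (expi t) = (cos t)%:C *+ 2.
  by apply/eqP; rewrite /expi mulr2n eq_complex /= subrr addr0 !eqxx.
rewrite rmorphD !rmorphM !fmorphV rmorphB !rmorphXn rmorph_nat rmorph1 -mulr_natr.
field.
by [].
Qed.

(* The projectors of the local measurement, weighted by the recorded results,
   add up to the observable of the chosen setting. *)
Lemma observableE (R : realType) (E : finType) (d : nat)
    (B1 : forall (e : E) (s : setting d),
       eigenbasis (weyl1 R d (val s).1 (val s).2))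
    (B2 : forall (e : E) (s : setting d),
       eigenbasis (weyl2 R d (val s).1 (val s).2)) (e : E) (s : setting d) :
  observable R s = \sum_kl (edge_result B1 B2 e s kl)%:C *: effect B1 B2 e s kl.
Proof.
have hd : (0 < d)%N by apply: leq_ltn_trans (ltn_ord (val s).1).
have hd0 : (d%:R : R) != 0 by rewrite pnatr_eq0 -lt0n.
rewrite /observable weyl_pair_adj ?(ltnW (ltn_ord _)) //.
have -> : weyl_pair R d (val s).1 (val s).2 =
  \sum_kl expi (phase (B1 e s) kl.1 + phase (B2 e s) kl.2) *: effect B1 B2 e s kl.
  rewrite /weyl_pair.
  apply: (etrans (congr2 (fun A B => A *t B) (eb_spectral (B1 e s)) (eb_spectral (B2 e s)))).
  rewrite tens_sum.
  by apply: eq_bigr => kl _; rewrite tensZ expiD.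
have -> : 1%:M = \sum_kl effect B1 B2 e s kl.
  have := tens_sum (fun k => evec (B1 e s) k *m (evec (B1 e s) k) ^t*)
                   (fun k => evec (B2 e s) k *m (evec (B2 e s) k) ^t*).
  by rewrite !eb_complete; apply: etrans; rewrite tens11.
rewrite adj_sum; last first.
  by move=> kl; rewrite /effect adj_tens !adjPP.
rewrite -big_split /= !scaler_sumr -big_split /=; apply: eq_bigr => kl _.
rewrite scalerDr !scalerA -!scalerDl; congr (_ *: _).
rewrite -mulrDr; have := coefE (phase (B1 e s) kl.1 + phase (B2 e s) kl.2) hd.
by [].
Qed.

(* Main.v *)
Require Import Defs.
From mathcomp Require Import all_boot all_order all_algebra.
From mathcomp Require Import complex mxtens.
From mathcomp Require Import reals sequences exp trigo.
From mathcomp Require Import classical_sets topology normedtype derive realfun.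
From mathcomp Require Import ring lra.

(** Each observable is a weighted sum of the projectors of its local measurement
    and the average of all the observables is [Phi], because the operators
    [M_(a, b)], (0, 0) included, sum to [d ^ 2 * Phi].  The settings of distinct edges are
    independent, so both products of edge results are unbiased and a single-copy
    outcome has mean [Tr (W rho)].  A convexity argument bounds its absolute
    value by [c = 2 * (1 + 1 / d)], whatever the number of edges, and Hoeffding's
    inequality for an interval of length [2 * c] gives the tail bound. *)

Set Implicit Arguments.
Unset Strict Implicit.
Unset Printing Implicit Defensive.

Import Order.TTheory GRing.Theory Num.Theory.
Import numFieldNormedType.Exports.
Local Open Scope ring_scope.
Local Open Scope complex_scope.
Local Open Scope sesquilinear_scope.

(** * Hoeffding's inequality *)

Lemma le_derive_ge0 (R : realType) (f df : R -> R) (a b : R) : a <= b ->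
  (forall t : R, is_derive t (1 : R) f (df t)) -> (forall t, a <= t -> 0 <= df t) ->
  f a <= f b.
Proof.
move=> ab fdf df0.
have cf : {within `[a, b], continuous f}%classic.
  apply: continuous_subspaceT => t; apply: differentiable_continuous.
  by apply/derivable1_diffP; apply: ex_derive.
have [c] := MVT_segment ab (fun t _ => fdf t) cf.
rewrite in_itv /= => /andP[ac _] E.
by rewrite -subr_ge0 E mulr_ge0 ?df0 // subr_ge0.
Qed.

(* With [D] the left-hand side, the quotient [u = D' / D] satisfies
   [u' = 1 - u ^ 2 <= 1] and [u 0 = x], whence [D' <= (x + t) * D]. *)
Lemma two_point_mgf_le (R : realType) (x t : R) : -1 <= x <= 1 -> 0 <= t ->
  (1 + x) / 2 * expR t + (1 - x) / 2 * expR (- t) <= expR (x * t + t ^+ 2 / 2).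
Proof.
move=> /andP[x1 x2] t0.
pose D s : R := (1 + x) / 2 * expR s + (1 - x) / 2 * expR (- s).
pose N s : R := (1 + x) / 2 * expR s - (1 - x) / 2 * expR (- s).
have D0 s : 0 < D s.
  rewrite /D; have := expR_gt0 s; have := expR_gt0 (- s).
  move: (expR _) (expR _) => p q p0 q0.
  by nra.
have dD s : is_derive s (1 : R) D (N s).
  by apply: is_derive_eq; rewrite /N /= ?scaler0 ?scaleN1r /GRing.scale /=; ring.
have dN s : is_derive s (1 : R) N (D s).
  by apply: is_derive_eq; rewrite /D /= ?scaler0 ?scaleN1r /GRing.scale /=; ring.
have dDV s : is_derive s (1 : R) (fun s => (D s)^-1) (- (N s / D s ^+ 2)).
  have Ds : D s != 0 by rewrite gt_eqF.
  apply: DeriveDef; first exact: derivableV.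
  by rewrite deriveV // derive_val /GRing.scale /=; ring.
have ND s : 0 <= s -> N s <= (x + s) * D s.
  move=> s0; rewrite -ler_pdivrMr // -subr_ge0.
  pose g s : R := (x + s) - N s * (D s)^-1.
  have dg r : is_derive r (1 : R) g ((N r / D r) ^+ 2).
    apply: is_derive_eq; have := D0 r; rewrite /GRing.scale /= => Dr.
    by field; rewrite gt_eqF.
  have -> : 0 = g 0.
    rewrite /g /N /D oppr0 expR0; field.
    by rewrite (_ : _ + _ = 2) ?pnatr_eq0 //; ring.
  by apply: (le_derive_ge0 s0 dg) => r _; rewrite sqr_ge0.
(* Integrating factor: by [ND], the quotient of [D s] by [expR (x * s + s ^+ 2 / 2)] is
   nonincreasing for [s >= 0]. The minus sign makes [h] nondecreasing, and [h 0 = -1]. *)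
pose h s : R := - (expR (- (x * s + s ^+ 2 / 2)) * D s).
have dh s : is_derive s (1 : R) h (expR (- (x * s + s ^+ 2 / 2)) * ((x + s) * D s - N s)).
  apply: is_derive_eq; rewrite /GRing.scale /=.
  by field.
have : h 0 <= h t.
  apply: (le_derive_ge0 t0 dh) => s s0.
  by rewrite mulr_ge0 ?expR_ge0 // subr_ge0 ND.
rewrite /h lerN2 /D expRN mulrC ler_pdivrMr ?expR_gt0 // => /le_trans; apply.
rewrite mulr0 expr0n /= mul0r addr0 oppr0 expR0 !mulr1 mul1r -mulrDl.
by rewrite (_ : _ + _ = 2) ?divff ?mul1r ?pnatr_eq0 //; ring.
Qed.

(** Convexity of the exponential: the tangent at [t * y] bounds it below at [t] and at [- t]. The
    weights [(1 + y) / 2] and [(1 - y) / 2] average these two points to [t * y], so the linear terms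
    cancel. *)
Lemma expR_le_two_point (R : realType) (t y : R) : -1 <= y <= 1 ->
  expR (t * y) <= (1 + y) / 2 * expR t + (1 - y) / 2 * expR (- t).
Proof.
move=> /andP[y1 y2].
have tangent s : expR (t * y) * (1 + (s - t * y)) <= expR s.
  by rewrite -[X in _ <= expR X](subrKC (t * y)) expRD ler_wpM2l ?expR_ge0 ?expR_ge1Dx.
have -> : expR (t * y) = (1 + y) / 2 * (expR (t * y) * (1 + (t - t * y)))
   + (1 - y) / 2 * (expR (t * y) * (1 + (- t - t * y))) by field.
by apply: lerD; apply: ler_wpM2l => //; lra.
Qed.

Section Hoeffding.
Context (R : realType) (T : finType) (p : T -> R).
Context (p_ge0 : forall r, 0 <= p r) (p_sum : \sum_r p r = 1).

Lemma mean_itv (X : T -> R) (a b : R) : (forall r, a <= X r <= b) ->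
  a <= \sum_r p r * X r <= b.
Proof.
move=> Xab; rewrite -[a]mul1r -[b]mul1r -p_sum !mulr_suml.
by apply/andP; split; apply: ler_sum => r _; apply: ler_wpM2l => //;
  have /andP[] := Xab r.
Qed.

(** The chord bound is affine in [Y r], so averaging it keeps only the mean, to which the two-point
    bound applies. *)
Lemma hoeffding_mgf (Y : T -> R) (t : R) : (forall r, -1 <= Y r <= 1) -> 0 <= t ->
  \sum_r p r * expR (t * Y r) <= expR (t * (\sum_r p r * Y r) + t ^+ 2 / 2).
Proof.
move=> Y1 t0; rewrite [t * _]mulrC.
apply: le_trans (two_point_mgf_le (mean_itv Y1) t0).
apply: (@le_trans _ _ (\sum_r p r * ((1 + Y r) / 2 * expR t + (1 - Y r) / 2 * expR (- t)))).
  by apply: ler_sum => r _; rewrite ler_wpM2l ?expR_le_two_point.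
rewrite le_eqVlt; apply/orP; left; apply/eqP.
transitivity (\sum_r (p r * ((expR t + expR (- t)) / 2)
                      + p r * Y r * ((expR t - expR (- t)) / 2))).
  by apply: eq_bigr => r _; field.
by rewrite big_split /= -!mulr_suml p_sum; field.
Qed.

(** Chernoff's method for [- X / c], whose upper tail is the lower tail of [X]; independence turns
    the exponential moment into an [m]-th power. *)
Lemma hoeffding_lower_tail (X : T -> R) (c : R) (m : nat) (eps : R) :
  0 < c -> (forall r, `|X r| <= c) -> (0 < m)%N -> 0 < eps ->
  \sum_(w : {ffun 'I_m -> T}
         | (\sum_(i < m) X (w i)) / m%:R - \sum_r p r * X r <= - eps)
     \prod_(i < m) p (w i)
  <= expR (- (m%:R * eps ^+ 2 / (2 * c ^+ 2))).
Proof.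
move=> c0 Xc m0 eps0.
pose Y r := - X r / c.
have Y1 r : -1 <= Y r <= 1.
  by rewrite -ler_norml normrM normrN normfV (gtr0_norm c0) ler_pdivrMr ?mul1r.
set mu := \sum_r p r * X r.
have muE : \sum_r p r * Y r = - mu / c.
  by rewrite mulNr -mulrN mulr_suml; apply: eq_bigr => r _; rewrite /Y; ring.
(* This is both the deviation threshold for [Y] and the minimiser of the exponent
   [s ^+ 2 / 2 - s * (eps / c)] in [s], which is why [t] occurs twice in [g]. *)
pose t := eps / c.
have t0 : 0 < t by rewrite divr_gt0.
pose g r := expR (t * (Y r + mu / c - t)).
(* On the event, the product of the [g (w i)] is at least 1; outside it, only nonnegative terms are
   added. *)
apply: (@le_trans _ _ (\sum_(w : {ffun 'I_m -> T}) \prod_(i < m) (p (w i) * g (w i)))).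
  rewrite big_mkcond /=; apply: ler_sum => w _.
  have P0 : 0 <= \prod_(i < m) p (w i) by apply: prodr_ge0.
  rewrite big_split /= -expR_sum; case: ifPn => [Aw|_]; last first.
    by rewrite mulr_ge0 ?expR_ge0.
  rewrite ler_peMr // -expR0 ler_expR -mulr_sumr mulr_ge0 ?(ltW t0) //.
  have mR : 0 < m%:R :> R by rewrite ltr0n.
  move: Aw; rewrite lerBlDr ler_pdivrMr // => Aw.
  rewrite !big_split /= sumr_const sumr_const card_ord.
  rewrite -mulr_suml sumrN -[_ *+ m]mulr_natl -[(- _) *+ m]mulr_natl /t -(pmulr_rge0 _ c0).
  have -> : c * (- (\sum_(i < m) X (w i)) / c + m%:R * (mu / c) + m%:R * - (eps / c))
     = - (\sum_(i < m) X (w i)) + (- eps + mu) * m%:R.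
    by field; rewrite gt_eqF.
  by rewrite addrC subr_ge0.
rewrite -(bigA_distr_bigA (fun _ r => p r * g r)) /= prodr_const card_ord.
(* Both sides are now [m]-th powers, so it suffices to compare a single factor with
   [expR (- (t ^+ 2 / 2))]. *)
have -> : m%:R * eps ^+ 2 / (2 * c ^+ 2) = m%:R * (t ^+ 2 / 2).
  by rewrite /t; field; rewrite gt_eqF.
rewrite -mulrN expRM_natl lerXn2r ?nnegrE ?expR_ge0 //.
  by apply: sumr_ge0 => r _; rewrite mulr_ge0 ?expR_ge0.
have -> : \sum_r p r * g r = (\sum_r p r * expR (t * Y r)) * expR (t * (mu / c) - t ^+ 2).
  rewrite mulr_suml; apply: eq_bigr => r _.
  by rewrite -mulrA -expRD /g; congr (_ * expR _); ring.
rewrite -ler_pdivlMr ?expR_gt0 // -expRN -expRD.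
apply: (le_trans (hoeffding_mgf Y1 (ltW t0))).
by rewrite muE ler_expR le_eqVlt; apply/orP; left; apply/eqP; field; rewrite gt_eqF.
Qed.

End Hoeffding.

(** * Range of the single-copy outcome *)

(* The pairs [(p, q)] in [K] form a convex set that is stable under
   multiplication by [(m, (1 + d * m) / (d + 1))] for both extreme values of
   [m], hence for every [m] between them. *)
Lemma outcome_bound (R : realType) (E : finType) (d : nat) (m : E -> R) :
  (2 <= d)%N -> (forall e, 2 / d%:R ^+ 2 - 1 <= m e <= 1) ->
  `| - (2 * d%:R / (d%:R - 1)) * (\prod_e m e)
     + (d%:R + 1) / (d%:R - 1) * (\prod_e ((1 + d%:R * m e) / (d%:R + 1))) |
  <= 2 * (1 + 1 / d%:R).
Proof.
move=> hd m1.
set D : R := d%:R in m1 *.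
have D2 : 2 <= D by rewrite /D ler_nat.
have D0 : 0 < D by lra.
have D1 : 0 < D - 1 by lra.
have Dn0 : D != 0 by rewrite gt_eqF.
pose v := D^-1.
have DV : D * v = 1 by rewrite divff.
have v0 : 0 < v by rewrite invr_gt0.
have v2 : 2 * v <= 1 by nra.
(* The outcome is [- (2 * D * p - (D + 1) * q) / (D - 1)], and [2 * D - 2 * v] is the claimed bound
   times [D - 1]. The bound on [p] controls the correction that appears at the lower extreme of
   [m e]. *)
pose K (p q : R) := -1 <= p <= 1 /\
  - (2 * D - 2 * v) <= 2 * D * p - (D + 1) * q <= 2 * D - 2 * v.
have : K (\prod_e m e) (\prod_e ((1 + D * m e) / (D + 1))).
  elim/big_rec2: _ => [|e q p _ [p1 L1]].
    by split; apply/andP; split; nra.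
  have /andP[m2 m3] := m1 e.
  have k0 : 0 < 2 - 2 * v ^+ 2 by nra.
  (* Barycentric coordinate of [m e]: 0 at the upper extreme 1, and 1 at the lower extreme, where
     [p] and [q] are multiplied by [2 * v ^+ 2 - 1] and [2 * v - 1]. *)
  pose s := (1 - m e) / (2 - 2 * v ^+ 2).
  have s0 : 0 <= s by rewrite divr_ge0 ?(ltW k0) // subr_ge0.
  have s1 : s <= 1.
    by rewrite ler_pdivrMr // /v exprVn; lra.
  have -> : m e = 1 - s * (2 - 2 * v ^+ 2) by rewrite /s divfK ?gt_eqF //; ring.
  have -> : (1 + D * (1 - s * (2 - 2 * v ^+ 2))) / (D + 1) = 1 - s * (2 - 2 * v).
    by rewrite /v; field; rewrite Dn0 gt_eqF //; lra.
  have P : -1 <= (1 - 2 * v ^+ 2) * p <= 1.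
    have [P1 P2] := andP p1.
    have : 0 <= 1 - 2 * v ^+ 2 <= 1 by apply/andP; split; nra.
    move: (1 - 2 * v ^+ 2) => a /andP[a0 a1].
    by apply/andP; split; nra.
  have conv (x y B : R) : - B <= x <= B -> - B <= y <= B ->
      - B <= (1 - s) * x - s * y <= B.
    by move=> /andP[x0 x1] /andP[y0 y1]; apply/andP; split; nra.
  split.
    have -> : (1 - s * (2 - 2 * v ^+ 2)) * p = (1 - s) * p - s * ((1 - 2 * v ^+ 2) * p).
      by ring.
    exact: conv.
  set L := 2 * D * p - (D + 1) * q in L1 *.
  have -> : 2 * D * ((1 - s * (2 - 2 * v ^+ 2)) * p)
      - (D + 1) * ((1 - s * (2 - 2 * v)) * q)
    = (1 - s) * L - s * ((1 - 2 * v) * L + (4 - 4 * v) * p).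
    by rewrite /L /v; field.
  apply: conv => //.
  have [P1 P2] := andP p1; have [L2 L3] := andP L1.
  (* Contracting [L] by [1 - 2 * v] leaves room for the correction in [p]: the left side is
     [2 * D - 2 * v - 4 * v * (1 - v)]. *)
  have B : (1 - 2 * v) * (2 * D - 2 * v) + (4 - 4 * v) <= 2 * D - 2 * v.
    have -> : (1 - 2 * v) * (2 * D - 2 * v) = 2 * D - 2 * v - 4 * (D * v) + 4 * v ^+ 2.
      by ring.
    by rewrite DV; nra.
  have b0 : 0 <= 1 - 2 * v by lra.
  have f0 : 0 <= 4 - 4 * v by lra.
  move: b0 f0 B; move: (1 - 2 * v) (4 - 4 * v) => b f b0 f0 B.
  by apply/andP; split; nra.
move=> [_]; move: (\prod_e _) (\prod_e _) => q p L1.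
have -> : - (2 * D / (D - 1)) * p + (D + 1) / (D - 1) * q
    = - ((2 * D * p - (D + 1) * q) / (D - 1)) by field; rewrite gt_eqF.
rewrite normrN normrM normfV (gtr0_norm D1) ler_pdivrMr //.
have -> : 2 * (1 + 1 / D) * (D - 1) = 2 * D - 2 * v by rewrite /v; field.
by rewrite ler_norml.
Qed.

(** * Expectations under the Born rule *)

Section Bigtens.
Context (R : realType) (E : finType) (d : nat).
Implicit Types A : E -> 'M[R[i]]_(d * d).

Lemma eq_bigtens A A' : A =1 A' -> bigtens A = bigtens A'.
Proof. by move=> AA'; apply/matrixP => x y; rewrite !mxE; apply: eq_bigr => e _; rewrite AA'. Qed.

Lemma bigtens_sum (J : finType) (F : E -> J -> 'M[R[i]]_(d * d)) :
  bigtens (fun e => \sum_j F e j) = \sum_(f : {ffun E -> J}) bigtens (fun e => F e (f e)).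
Proof.
apply/matrixP => x y; rewrite mxE summxE.
under eq_bigr => e _ do rewrite summxE.
by rewrite bigA_distr_bigA; apply: eq_bigr => f _; rewrite mxE.
Qed.

Lemma bigtensZ (c : E -> R[i]) A :
  bigtens (fun e => c e *: A e) = (\prod_e c e) *: bigtens A.
Proof.
apply/matrixP => x y; rewrite !mxE -big_split.
by apply: eq_bigr => e _; rewrite !mxE.
Qed.

Lemma bigtens1 : bigtens (fun _ : E => 1%:M : 'M[R[i]]_(d * d)) = 1%:M.
Proof.
apply/matrixP => x y; rewrite !mxE.
have [->|xy] := eqVneq x y; first by rewrite big1 // => e _; rewrite mxE eqxx.
have [e xye] : exists e, basis_index x e != basis_index y e.
  apply/existsP; apply: contraNT xy; rewrite negb_exists => /forallP h.
  by apply/eqP/enum_val_inj/ffunP => e; have := h e; rewrite negbK => /eqP.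
by rewrite (bigD1 e) //= mxE (negbTE xye) mul0r.
Qed.

(** Makes the Born weight of a product of local projectors a value of the quadratic form of [rho],
    hence nonnegative. *)
Lemma bigtens_rank1 (w : E -> 'I_(d * d) -> R[i]) A :
  (forall e x y, A e x y = w e x * conjc (w e y)) ->
  exists W : 'cV[R[i]]_(netdim E d), bigtens A = W *m W ^t*.
Proof.
move=> AE; exists (\col_x \prod_e w e (basis_index x e)).
apply/matrixP => x y; rewrite !mxE big_ord1 !mxE.
apply: (etrans _ (congr1 _ (esym (rmorph_prod (@conjc R) _ _ _)))).
by rewrite -big_split; apply: eq_bigr => e _; rewrite AE.
Qed.

End Bigtens.

Lemma ReD (R : realType) (x y : R[i]) : complex.Re (x + y) = complex.Re x + complex.Re y.
Proof. by case: x; case: y. Qed.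

Lemma Re_tr_sum (R : realType) n (rho : 'M[R[i]]_n) (I : finType) (F : I -> 'M[R[i]]_n) :
  complex.Re (\tr (rho *m \sum_i F i)) = \sum_i complex.Re (\tr (rho *m F i)).
Proof.
by rewrite mulmx_sumr (raddf_sum (@mxtrace _ n)); exact: (big_morph _ (@ReD R) erefl).
Qed.

Lemma ReZ (R : realType) (a : R) (z : R[i]) : complex.Re (a%:C * z) = a * complex.Re z.
Proof. by case: z => x y /=; rewrite mul0r subr0. Qed.

Section RunExpectation.
Context (R : realType) (E : finType) (d : nat).
Context (B1 : forall (e : E) (s : setting d), eigenbasis (weyl1 R d (val s).1 (val s).2)).
Context (B2 : forall (e : E) (s : setting d), eigenbasis (weyl2 R d (val s).1 (val s).2)).

(** Multilinearity: expanding the tensor product first over settings, then over results, gives one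
    term per run, and the edge weights factor out of it as scalars. *)
Lemma expectation_prod (rho : 'M[R[i]]_(netdim E d)) (g : E -> setting d -> 'I_d * 'I_d -> R) :
  \sum_(r : run E d) run_prob B1 B2 rho r * \prod_e g e (r.1 e) (r.2 e) =
  complex.Re (\tr (rho *m bigtens (fun e =>
    \sum_s (d%:R ^+ 2 - 1)^-1%:C *: \sum_kl (g e s kl)%:C *: effect B1 B2 e s kl))).
Proof.
under eq_bigtens => e do under eq_bigr => s _ do rewrite scaler_sumr.
rewrite bigtens_sum Re_tr_sum.
rewrite -(pair_bigA _ (fun a b => run_prob B1 B2 rho (a, b) * \prod_e g e (a e) (b e))) /=.
apply: eq_bigr => fs _.
rewrite bigtens_sum Re_tr_sum.
apply: eq_bigr => fk _.
under eq_bigtens => e do rewrite scalerA -rmorphM.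
rewrite bigtensZ -scalemxAr mxtraceZ -rmorph_prod ReZ big_split /run_prob /=.
by rewrite mulrAC.
Qed.

Lemma run_prob_ge0 (rho : 'M[R[i]]_(netdim E d)) (r : run E d) :
  (2 <= d)%N -> state rho -> 0 <= run_prob B1 B2 rho r.
Proof.
move=> hd [_ rho_psd _]; apply: mulr_ge0.
  apply: prodr_ge0 => e _; rewrite invr_ge0 subr_ge0 -natrX ler1n.
  by rewrite expn_gt0 (ltnW hd).
pose w e x := evec (B1 e (r.1 e)) (r.2 e).1 (mxtens_unindex x).1 0
            * evec (B2 e (r.1 e)) (r.2 e).2 (mxtens_unindex x).2 0.
have [|W ->] := @bigtens_rank1 R E d w (fun e => effect B1 B2 e (r.1 e) (r.2 e)).
  move=> e x y; rewrite /w /effect.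
  case: (mxtens_indexP x) => i i'; case: (mxtens_indexP y) => j j'.
  rewrite tensmxE !mxtens_indexK /= !mxE !big_ord1 !mxE.
  by rewrite rmorphM mulrACA.
have := rho_psd W; rewrite mulmxA mxtrace_mulC mulmxA /mxtrace big_ord1.
by rewrite lecE => /andP[].
Qed.

End RunExpectation.

(** * Average of the observables *)

Lemma outer_mxE (R : realType) n (u v : 'cV[R[i]]_n) i j :
  (u *m v ^t*) i j = u i 0 * conjc (v j 0).
Proof. by rewrite !mxE big_ord1 !mxE. Qed.

Lemma phi_plusE (R : realType) d (i j : 'I_d) :
  phi_plus R d (mxtens_index (i, j)) 0 = (Num.sqrt d%:R)^-1%:C * (i == j)%:R.
Proof.
rewrite /phi_plus mxE summxE; congr (_ * _).
rewrite (bigD1 i) //= big1 ?addr0 => [|k ki]; rewrite !mxE mxtens_indexK /=.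
  by rewrite eqxx mul1r andbT eq_sym.
by rewrite [i == k]eq_sym (negbTE ki) mul0r.
Qed.

Lemma PhiE (R : realType) d (i i' j j' : 'I_d) :
  Phi R d (mxtens_index (i, i')) (mxtens_index (j, j')) = d%:R^-1 * (i == i')%:R * (j == j')%:R.
Proof.
rewrite /Phi outer_mxE !phi_plusE rmorphM rmorph_nat mulrACA mulrA.
congr (_ * _ * _).
rewrite [X in _ * X]conjc_real.
by rewrite -rmorphM -invfM -expr2 sqr_sqrtr ?ler0n // fmorphV rmorph_nat.
Qed.

Lemma Phi_adj (R : realType) d : (Phi R d) ^t* = Phi R d.
Proof. exact: adjPP. Qed.

(** Half-angle formula: [cos x = 1 - 2 * sin (x / 2) ^+ 2], and the sine is positive on the open
    interval from 0 to [pi]. *)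
Lemma cos_lt1 (R : realType) (x : R) : 0 < x < 2 * pi -> cos x < 1.
Proof.
move=> /andP[x0 x2].
have -> : x = (x / 2) *+ 2 by rewrite -mulr_natr divfK // pnatr_eq0.
rewrite cos_mulr2n cos2sin2.
have : 0 < sin (x / 2) by apply: sin_gt0_pi; apply/andP; split; lra.
by move: (sin _) => s s0; nra.
Qed.

Section AverageObservable.
Context (R : realType) (d : nat).
Local Notation w := (expi (2 * pi / d%:R) : R[i]).

(** [w] is a primitive [d]-th root of unity: [w ^+ (j - i)] has real part below 1, its angle lying
    strictly between 0 and [2 * pi]. *)
Lemma root_unity_neq (i j : nat) : (i < j < d)%N -> w ^+ i != w ^+ j.
Proof.
move=> /andP[ij jd].
have d0 : 0 < d%:R :> R by rewrite ltr0n (leq_ltn_trans _ jd).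
rewrite -(subnKC (ltnW ij)) exprD -subr_eq0 -{1}[w ^+ i]mulr1 -mulrBr mulf_neq0 //.
  by apply/expf_neq0/eqP => w0; have := wcwX R d 1; rewrite w0 !expr1 mul0r => /esym/eqP;
     rewrite oner_eq0.
rewrite subr_eq0 -expiMn /expi eq_complex negb_and /= eq_sym lt_eqF //.
apply: cos_lt1; rewrite -[_ *+ (j - i)]mulr_natr; apply/andP; split.
  by rewrite !mulr_gt0 ?invr_gt0 ?pi_gt0 // ltr0n subn_gt0.
rewrite -mulrA gtr_pMr ?mulr_gt0 ?pi_gt0 // ltr_pdivrMl // mulr1 ltr_nat.
by rewrite (leq_ltn_trans (leq_subr _ _)).
Qed.

(** Orthogonality of the characters of the cyclic group: off the diagonal this is a geometric sum
    whose ratio [z] satisfies [z ^+ d = 1] and [z != 1]. *)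
Lemma sum_phases (j j' : 'I_d) :
  \sum_(b < d) (w ^+ (j * b) * (conjc w) ^+ (j' * b)) = d%:R * (j == j')%:R.
Proof.
have d0 : (0 < d)%N by apply: leq_ltn_trans (ltn_ord j).
have [->|jj'] := eqVneq j j'.
  rewrite (eq_bigr (fun _ => 1)) => [|b _]; last exact: wcwX.
  by rewrite sumr_const card_ord mulr1.
pose z := w ^+ j * (conjc w) ^+ j'.
rewrite (eq_bigr (fun b : 'I_d => z ^+ b)) => [|b _]; last by rewrite exprMn !exprM.
have zd : z ^+ d = 1.
  by rewrite exprMn -!exprM mulnC exprM wd // mulnC exprM cwd // !expr1n mulr1.
have z1 : z - 1 != 0.
  rewrite subr_eq0; apply/eqP => z1.
  have : w ^+ j = w ^+ j'.
    by rewrite -[LHS]mulr1 -(wcwX R d j') [X in _ * X]mulrC mulrA -/z z1 mul1r.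
  move/eqP; apply/negP; have [jj|jj|/val_inj jj] := ltngtP j j'.
  - by rewrite root_unity_neq // jj ltn_ord.
  - by rewrite eq_sym root_unity_neq // jj ltn_ord.
  - by rewrite jj eqxx in jj'.
by rewrite mulr0; apply/(mulfI z1); rewrite -subrX1 zd subrr mulr0.
Qed.

Lemma weyl_pairE (a b : nat) (i i' j j' : 'I_d) :
  weyl_pair R d a b (mxtens_index (i, i')) (mxtens_index (j, j')) =
  ((i : nat) == (j + a) %% d)%N%:R * ((i' : nat) == (j' + a) %% d)%N%:R
  * (w ^+ (j * b) * (conjc w) ^+ (j' * b)).
Proof.
have tE (A B : 'M[R[i]]_d) p q : A i j = p -> B i' j' = q ->
    (A *t B) (mxtens_index (i, i')) (mxtens_index (j, j')) = p * q.
  by move=> <- <-; exact: tensmxE.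
rewrite mulrACA; apply: tE.
  exact: weyl1E.
exact: weyl2E.
Qed.

(** The sum over [b] forces [j = j'] with weight [d]; then exactly one shift [a] takes [j] to [i],
    and it forces [i = i']. The factor [d] is [d ^ 2] times the entry [1 / d] of [Phi]. *)
Lemma sum_weyl_pair :
  \sum_(ab : 'I_d * 'I_d) weyl_pair R d ab.1 ab.2 = d%:R ^+ 2 *: Phi R d.
Proof.
apply/matrixP => x y; rewrite summxE mxE.
case: (mxtens_indexP x) => i i'; case: (mxtens_indexP y) => j j'.
have d0 : (0 < d)%N by apply: leq_ltn_trans (ltn_ord j).
have dn0 : d%:R != 0 :> R[i] by rewrite pnatr_eq0 -lt0n.
rewrite PhiE -(pair_bigA _ (fun a b : 'I_d => weyl_pair R d a b _ _)) /=.
under eq_bigr => a _.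
  under eq_bigr => b _ do rewrite weyl_pairE.
  rewrite -mulr_sumr sum_phases.
  over.
rewrite -mulr_suml; have [<-|jj'] := eqVneq j j'; last by rewrite !mulr0.
have inj_shift (a b : 'I_d) : ((j + a) %% d)%N = ((j + b) %% d)%N -> a = b.
  move/eqP; rewrite eqn_modDl !modn_small // => /eqP; exact: val_inj.
(* The residue of [i - j], with [d] added to avoid truncated subtraction. *)
pose a0 : 'I_d := Ordinal (ltn_pmod (i + (d - j)) d0).
have a0E : ((j + a0) %% d)%N = i.
  by rewrite modnDmr addnCA subnKC ?(ltnW (ltn_ord j)) // modnDr modn_small.
rewrite (bigD1 a0) //= big1 => [|a aa0].
  by rewrite a0E eqxx mul1r addr0 [i == i']eq_sym; field.
case: eqP => [ia|_]; last by rewrite mul0r.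
case/eqP: aa0; apply: inj_shift.
by rewrite -ia a0E.
Qed.

Lemma sum_setting (F : 'I_d * 'I_d -> 'M[R[i]]_(d * d)) (d0 : (0 < d)%N) :
  \sum_(s : setting d) F (val s) = \sum_ab F ab - F (Ordinal d0, Ordinal d0).
Proof.
rewrite [X in _ = X - _](bigD1 (Ordinal d0, Ordinal d0)) //= addrAC subrr add0r.
rewrite -(big_sub [pred ab : 'I_d * 'I_d | ~~ ((ab.1 == 0%N :> nat) && (ab.2 == 0%N :> nat))] F).
by apply: eq_bigl => -[a b]; rewrite !inE xpair_eqE.
Qed.

Lemma card_setting (d0 : (0 < d)%N) : #|setting d|%:R = d%:R ^+ 2 - 1 :> R.
Proof.
pose o : 'I_d * 'I_d := (Ordinal d0, Ordinal d0).
rewrite card_sig (eq_card (_ : _ =i predC1 o)) => [|[a b]]; last by rewrite !inE.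
by rewrite cardC1 card_prod card_ord -subn1 natrB ?muln_gt0 ?d0 // natrM.
Qed.

(** The excluded pair [(0, 0)] would contribute exactly the identity. The sum of [F] over all pairs
    is the identity plus [(d ^ 2 - 1) * Phi], so dropping that pair leaves a pure multiple of
    [Phi]. *)
Lemma average_observable : (2 <= d)%N ->
  \sum_(s : setting d) observable R s = (d%:R ^+ 2 - 1) *: Phi R d.
Proof.
move=> hd; have d0 : (0 < d)%N by apply: ltnW.
have dn0 : d%:R != 0 :> R[i] by rewrite pnatr_eq0 -lt0n.
pose F (ab : 'I_d * 'I_d) : 'M[R[i]]_(d * d) := (d%:R ^+ 2)^-1 *: 1%:M
  + ((d%:R ^+ 2 - 1) / (2 * d%:R ^+ 2)) *:
      (weyl_pair R d ab.1 ab.2 + (weyl_pair R d ab.1 ab.2) ^t*).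
rewrite (eq_bigr (fun s : setting d => F (val s))) => [|s _]; last first.
  by rewrite /observable weyl_pair_adj ?(ltnW (ltn_ord _)).
have F00 : F (Ordinal d0, Ordinal d0) = 1%:M.
  rewrite /F /= /weyl_pair /weyl1 /weyl2 !expr0 mulmx1 tens11 trmx1 map_mx1.
  rewrite -mulr2n -[1%:M *+ 2]scaler_nat scalerA -scalerDl -[RHS]scale1r; congr (_ *: _).
  by field.
have adj_suml (G : 'I_d * 'I_d -> 'M[R[i]]_(d * d)) :
    \sum_ab (G ab) ^t* = (\sum_ab G ab) ^t*.
  apply/matrixP => x y; rewrite adjE !summxE rmorph_sum.
  by apply: eq_bigr => ab _; rewrite adjE.
rewrite sum_setting F00 /F /= big_split /= sumr_const card_prod card_ord.
rewrite -scaler_sumr big_split /= adj_suml sum_weyl_pair.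
have -> : (d%:R ^+ 2 *: Phi R d) ^t* = d%:R ^+ 2 *: Phi R d.
  apply/matrixP => x y; rewrite -[in RHS]Phi_adj [RHS]mxE !adjE mxE.
  by rewrite rmorphM rmorphXn rmorph_nat.
rewrite -mulr2n -[(_ *: Phi R d) *+ 2]scaler_nat -[_ *+ (d * d)]scaler_nat natrM !scalerA.
rewrite (_ : d%:R * d%:R * (d%:R ^+ 2)^-1 = 1) ?scale1r; last by field.
rewrite addrAC subrr add0r; congr (_ *: _).
by field.
Qed.

End AverageObservable.

(** * The single-copy outcome *)

Section SingleCopy.
Context (R : realType) (E : finType) (d : nat) (hd : (2 <= d)%N).
Context (B1 : forall (e : E) (s : setting d), eigenbasis (weyl1 R d (val s).1 (val s).2)).
Context (B2 : forall (e : E) (s : setting d), eigenbasis (weyl2 R d (val s).1 (val s).2)).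

Let prob_setting_neq0 : (d%:R ^+ 2 - 1 : R) != 0.
Proof. by rewrite gt_eqF // subr_gt0 -natrX ltr1n (@ltn_exp2l d 0 2). Qed.

Lemma sum_effect (e : E) (s : setting d) : \sum_kl effect B1 B2 e s kl = 1%:M.
Proof.
have := tens_sum (fun k => evec (B1 e s) k *m (evec (B1 e s) k) ^t*)
                 (fun k => evec (B2 e s) k *m (evec (B2 e s) k) ^t*).
by rewrite !eb_complete tens11 => <-.
Qed.

(** Serves twice: for the normalisation of [run_prob] and for the constant term of the affine
    results. *)
Lemma average_effect (e : E) :
  \sum_s (d%:R ^+ 2 - 1)^-1%:C *: \sum_kl effect B1 B2 e s kl = 1%:M.
Proof.
under eq_bigr => s _ do rewrite sum_effect.
rewrite sumr_const -scaler_nat scalerA -(rmorph_nat (@real_complex R)) -rmorphM.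
by rewrite card_setting ?(ltnW hd) // mulfV // scale1r.
Qed.

Lemma average_edge_result (e : E) :
  \sum_s (d%:R ^+ 2 - 1)^-1%:C *: \sum_kl (edge_result B1 B2 e s kl)%:C *: effect B1 B2 e s kl
  = Phi R d.
Proof.
under eq_bigr => s _ do rewrite -observableE.
rewrite -scaler_sumr average_observable // scalerA -[X in _ * X](_ : (d%:R ^+ 2 - 1)%:C = _).
  by rewrite -rmorphM mulVf // scale1r.
by rewrite rmorphB rmorphXn rmorph_nat rmorph1.
Qed.

Lemma average_affine_result (e : E) :
  \sum_s (d%:R ^+ 2 - 1)^-1%:C *: \sum_kl
     ((1 + d%:R * edge_result B1 B2 e s kl) / (d%:R + 1))%:C *: effect B1 B2 e s kl
  = (d%:R + 1)^-1 *: (1%:M + d%:R *: Phi R d).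
Proof.
rewrite -(average_effect e) -(average_edge_result e) scaler_sumr -big_split scaler_sumr /=.
apply: eq_bigr => s _.
rewrite [d%:R *: (_ *: _)]scalerA [d%:R * _]mulrC -scalerA -scalerDr.
rewrite [RHS]scalerA [(_ + _)^-1 * _]mulrC -scalerA; congr (_ *: _).
rewrite scaler_sumr -big_split scaler_sumr /=; apply: eq_bigr => kl _.
rewrite scalerA -{2}[effect _ _ _ _ _]scale1r -scalerDl scalerA; congr (_ *: _).
move: (edge_result _ _ _ _ _) => x.
by rewrite rmorphM fmorphV !rmorphD !rmorphM rmorph1 rmorph_nat mulrC.
Qed.

(** The endpoints are the values at cosine -1 and 1, the extremes expected by [outcome_bound]. *)
Lemma edge_result_itv (e : E) (s : setting d) kl :
  2 / d%:R ^+ 2 - 1 <= edge_result B1 B2 e s kl <= 1.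
Proof.
have d0 : (0 : R) < d%:R ^+ 2 by rewrite exprn_gt0 // ltr0n (ltnW hd).
have d1 : (1 : R) <= d%:R ^+ 2 by rewrite -natrX ler1n expn_gt0 (ltnW hd).
rewrite /edge_result; set c := cos _.
have c1 : -1 <= c by apply: cos_geN1.
have c2 : c <= 1 by apply: cos_le1.
have E1 : 1 / d%:R ^+ 2 + (d%:R ^+ 2 - 1) / d%:R ^+ 2 * c
    = 1 - (d%:R ^+ 2 - 1) / d%:R ^+ 2 * (1 - c) by field; rewrite -(sqrf_eq0 d%:R) gt_eqF.
have E2 : 2 / d%:R ^+ 2 - 1 = 1 - (d%:R ^+ 2 - 1) / d%:R ^+ 2 * 2 :> R.
  by field; rewrite -(sqrf_eq0 d%:R) gt_eqF.
have k0 : (0 : R) <= (d%:R ^+ 2 - 1) / d%:R ^+ 2 by rewrite divr_ge0 ?(ltW d0) // subr_ge0.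
rewrite E1 E2; move: (_ / _) k0 => k k0.
by apply/andP; split; nra.
Qed.

Context (rho : 'M[R[i]]_(netdim E d)) (rho_state : state rho).

(** The case of the constant edge function 1: every averaged factor is the identity, which leaves
    the trace of [rho]. *)
Lemma run_prob_sum : \sum_r run_prob B1 B2 rho r = 1.
Proof.
rewrite (eq_bigr (fun r => run_prob B1 B2 rho r * \prod_(e : E) 1)) => [|r _]; last first.
  by rewrite big1 ?mulr1.
rewrite (expectation_prod B1 B2 rho (fun _ _ _ => 1)).
rewrite (@eq_bigtens _ _ _ _ (fun _ => 1%:M)) => [|e].
  by rewrite bigtens1 mulmx1; case: rho_state => _ _ ->.
rewrite -(average_effect e); apply: eq_bigr => s _; congr (_ *: _).
by apply: eq_bigr => kl _; rewrite rmorph1 scale1r.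
Qed.

Lemma run_outcome_mean :
  \sum_r run_prob B1 B2 rho r * run_outcome B1 B2 r
  = complex.Re (\tr (witness R E d *m rho)).
Proof.
pose m (r : run E d) e := edge_result B1 B2 e (r.1 e) (r.2 e).
transitivity (- (2 * d%:R / (d%:R - 1))
      * (\sum_r run_prob B1 B2 rho r * \prod_e m r e)
    + (d%:R + 1) / (d%:R - 1)
      * (\sum_r run_prob B1 B2 rho r * \prod_e ((1 + d%:R * m r e) / (d%:R + 1)))).
  rewrite !mulr_sumr -big_split; apply: eq_bigr => r _ /=.
  by rewrite /run_outcome /m; ring.
rewrite (expectation_prod B1 B2 rho (fun e s kl => edge_result B1 B2 e s kl)).
rewrite (expectation_prod B1 B2 rho
  (fun e s kl => (1 + d%:R * edge_result B1 B2 e s kl) / (d%:R + 1))).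
rewrite (eq_bigtens average_edge_result) (eq_bigtens average_affine_result).
(* The coefficients of the witness are real, so they can be pulled out of [complex.Re]. *)
have coef1 : - (2 * d%:R / (d%:R - 1)) = (- (2 * d%:R / (d%:R - 1)))%:C :> R[i].
  by rewrite !(rmorphN, rmorphM, fmorphV, rmorphB, rmorph_nat, rmorph1).
have coef2 : (d%:R + 1) / (d%:R - 1) = ((d%:R + 1) / (d%:R - 1))%:C :> R[i].
  by rewrite !(rmorphD, rmorphN, rmorphM, fmorphV, rmorph_nat, rmorph1).
rewrite [in RHS]mxtrace_mulC /witness coef1 coef2 mulmxDr -!scalemxAr mxtraceD.
by rewrite !mxtraceZ ReD !ReZ.
Qed.

Lemma run_outcome_norm_le r : `|run_outcome B1 B2 r| <= 2 * (1 + 1 / d%:R).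
Proof. by apply: outcome_bound => // e; apply: edge_result_itv. Qed.

End SingleCopy.

(** * Tail bound for the average outcome *)

Theorem mainTheorem9 (R : realType) (d : nat) (hd : (2 <= d)%N)
    (V : finType) (adj : rel V)
    (adj_sym : symmetric adj) (adj_irr : irreflexive adj)
    (adj_conn : forall u v, connect adj u v) (hV : (2 <= #|V|)%N)
    (rho : 'M[R[i]]_(netdim (edge adj) d)) (hrho : state rho)
    (B1 : forall (e : edge adj) (s : setting d),
       eigenbasis (weyl1 R d (val s).1 (val s).2))
    (B2 : forall (e : edge adj) (s : setting d),
       eigenbasis (weyl2 R d (val s).1 (val s).2))
    (m : nat) (hm : (0 < m)%N) (eps : R) (heps : 0 < eps) :
  Pr B1 B2 rho
     [pred w : {ffun 'I_m -> run (edge adj) d} |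
        average_outcome B1 B2 w
          - complex.Re (\tr (witness R (edge adj) d *m rho)) <= - eps]
  <= expR (- (m%:R * eps ^+ 2 / (8 * (1 + 1 / d%:R) ^+ 2))).
Proof.
have c0 : 0 < 2 * (1 + 1 / d%:R) :> R.
  by rewrite mulr_gt0 // addr_gt0 // divr_gt0 // ltr0n (ltnW hd).
(* The denominator is [2 * c ^+ 2] for the uniform bound [c = 2 * (1 + 1 / d)] on a single-copy
   outcome. *)
have -> : 8 * (1 + 1 / d%:R) ^+ 2 = 2 * (2 * (1 + 1 / d%:R)) ^+ 2 :> R by ring.
have := hoeffding_lower_tail (fun r => run_prob_ge0 B1 B2 r hd hrho)
  (run_prob_sum hd B1 B2 hrho) c0 (run_outcome_norm_le hd B1 B2) hm heps.
by rewrite run_outcome_mean.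
Qed.
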